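(* Let $(\lambda_k)_{k\ge 1}$ be an increasing sequence of positive reals satisfying $$\sum_{\substack{k\neq\ell,\ k'\neq\ell'\\ (k,\ell)\neq(k',\ell')}} \big(1-|(\lambda_k-\lambda_\ell)-(\lambda_{k'}-\lambda_{\ell'})|\big)_+^2<\infty,$$ where the sum runs over all quadruples $(k,\ell,k',\ell')$ of positive integers with $k\ne \ell$, $k'\neq\ell'$ and $(k,\ell)\neq(k',\ell')$. Let $(a_k)_{k\ge 1}$ be a sequence of complex numbers such that the set $$\Big\{t\in\mathbb R:\ \sum_{k\ge 1} a_k e^{i\lambda_k t}\ \text{converges}\Big\}$$ has positive Lebesgue measure. Then the series $\sum_{k=1}^\infty |a_k|^2$ converges.
   Context: For a real number $x$, $x_+=\max(x,0)$, and $(x)_+^2=(x_+)^2$. *)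

(* Defs.v *)
From HB Require Import structures.
From mathcomp Require Import all_boot all_order all_algebra.
From mathcomp Require Import all_classical all_reals all_analysis.
From mathcomp Require Import complex.

Set Implicit Arguments.
Unset Strict Implicit.
Unset Printing Implicit Defensive.

Import Order.TTheory GRing.Theory Num.Theory.
Import numFieldNormedType.Exports.

Local Open Scope classical_set_scope.
Local Open Scope ring_scope.

Definition pospart (R : realType) (x : R) : R := Num.max x 0.

(* The unit complex number e^{ix}. *)
Definition expi (R : realType) (x : R) : R[i] := (cos x +i* sin x)%C.

Definition gap (R : realType) (lambda : nat -> R) (p : nat * nat) : R :=
  lambda p.1 - lambda p.2.

(* ((k, l), (k', l')) with k != l, k' != l' and (k, l) != (k', l'). Sequences
   are indexed from 0, so the term usually written with index k >= 1 is the one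
   with index k - 1 here. *)
Definition gap_quadruples : set ((nat * nat) * (nat * nat)) :=
  [set pq | [/\ pq.1.1 <> pq.1.2, pq.2.1 <> pq.2.2 & pq.1 <> pq.2]].

(* [R[i]^o] carries the topology of the complex modulus. *)
Definition convergence_set (R : realType) (lambda : nat -> R) (a : nat -> R[i]) :
    set R :=
  [set t | cvgn (series (fun k => a k * expi (lambda k * t) : R[i]^o))].

(* Main.v *)
Require Import Defs.
From HB Require Import structures.
From mathcomp Require Import all_boot all_order all_algebra.
From mathcomp Require Import all_classical all_reals all_analysis.
From mathcomp Require Import complex.
From mathcomp Require Import finmap ring lra.

Set Implicit Arguments.
Unset Strict Implicit.
Unset Printing Implicit Defensive.

Import Order.TTheory GRing.Theory Num.Theory.
Import numFieldNormedType.Exports.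

Local Open Scope classical_set_scope.
Local Open Scope ring_scope.

(** If the partial sums S_n converge on a set of positive measure, then they are
    bounded, |S_n|^2 <= M, on a bounded set A of positive measure m
    ([partial_sum_level_pos]). Integrating |S_N - S_n|^2 over A and expanding
    the square gives m times the sum of the |a_k|^2, n <= k < N, plus
    off-diagonal terms whose coefficients are the Fourier coefficients
    h(lambda_k - lambda_l), k <> l, of the indicator function of A. If the
    |h(lambda_k - lambda_l)|^2 are summable over k <> l, then for n large the
    Cauchy-Schwarz inequality makes the off-diagonal part at most half of the
    diagonal one ([diagonal_dominance]), and the sum of the |a_k|^2, n <= k < N,
    is bounded independently of N.

    Summability comes from the hypothesis on the gaps. A convergent series has
    finitely many terms above 1/4, hence, apart from finitely many indices, the
    gaps lambda_k - lambda_l are pairwise at distance at least 1/2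
    ([separated_gaps]). For such separated frequencies a Bessel inequality holds
    on every bounded set ([bessel]). It is dual to the large sieve bound
    [large_sieve] for the L^2 norm on A of a trigonometric polynomial: majorize
    the indicator function of A by the weight L^2 - t^2 on [-L, L], whose
    Fourier transform decays like 1 / x^2 because the weight vanishes at both
    ends, and apply Schur's test to the matrix of its values at the differences
    of frequencies.

    Everything is written with real integrals: the complex coefficients
    x + i y enter through their real and imaginary parts. *)

(** * Integrals of trigonometric sums over bounded sets *)

Definition bounded_measurable (R : realType) (A : set (measurableTypeR R)) :=
  measurable A /\ exists T : R, A `<=` `[- T, T].

Lemma continuous_integrable (R : realType) (A : set (measurableTypeR R)) (f : R -> R) :
  bounded_measurable A -> continuous f ->
  (@lebesgue_measure R).-integrable A (EFin \o f).
Proof.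
move=> [mA [T AT]] cf.
have mT : measurable (`[- T, T] : set (measurableTypeR R)) by exact: measurable_itv.
refine (integrableS mT mA AT _).
apply: continuous_compact_integrable; first exact: segment_compact.
exact: continuous_subspaceT.
Qed.

Lemma continuous_sumr (R : realType) (I : Type) (s : seq I) (P : pred I)
    (F : I -> R -> R) :
  (forall i, continuous (F i)) -> continuous (fun t => \sum_(i <- s | P i) F i t).
Proof.
move=> cF t; elim: s => [|i s IHs].
  by under eq_fun do rewrite big_nil; exact: cvg_cst.
under eq_fun do rewrite big_cons.
by case: ifP => // _; apply: continuousD; [exact: cF|exact: IHs].
Qed.

Lemma Rintegral_sumr (R : realType) (A : set (measurableTypeR R)) (I : Type) (s : seq I)
    (P : pred I) (F : I -> R -> R) :
  bounded_measurable A -> (forall i, continuous (F i)) ->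
  \int[lebesgue_measure]_(t in A) (\sum_(i <- s | P i) F i t) =
  \sum_(i <- s | P i) \int[lebesgue_measure]_(t in A) F i t.
Proof.
move=> bA cF; elim: s => [|i s IHs].
  under eq_Rintegral do rewrite big_nil.
  by rewrite big_nil Rintegral_cst ?mul0r//; exact: bA.1.
under eq_Rintegral do rewrite big_cons.
rewrite big_cons -IHs; case: ifP => // _.
rewrite RintegralD//; first exact: bA.1.
- exact: continuous_integrable.
- by apply: continuous_integrable => //; exact: continuous_sumr.
Qed.

Lemma le_RintegralS (R : realType) (A B : set (measurableTypeR R)) (f g : R -> R) :
  bounded_measurable A -> bounded_measurable B -> A `<=` B ->
  continuous f -> continuous g ->
  {in A, forall t, f t <= g t} -> {in B, forall t, 0 <= g t} ->
  \int[lebesgue_measure]_(t in A) f t <= \int[lebesgue_measure]_(t in B) g t.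
Proof.
move=> bA bB AB cf cg fg g0.
apply: (@le_trans _ _ (\int[lebesgue_measure]_(t in A) g t)).
  apply: le_Rintegral => //; first exact: bA.1.
  - exact: continuous_integrable.
  - exact: continuous_integrable.
  - by move=> t At; apply: fg; rewrite in_setE.
have mA := bA.1; have mB := bB.1.
rewrite -[in leRHS](setDUK AB) Rintegral_setU//.
- rewrite lerDl Rintegral_ge0// => t [Bt _].
  by apply: g0; rewrite in_setE.
- exact: measurableD.
- by rewrite setDUK//; exact: continuous_integrable.
- by rewrite disj_set2E setDE setIC -setIA setICl setI0.
Qed.

Section trigonometric_sums.
Context {R : realType} {I : finType}.
Implicit Types (P : pred I) (x y f : I -> R).

Definition re_trig P x y f (t : R) :=
  \sum_(i | P i) (x i * cos (f i * t) - y i * sin (f i * t)).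

Definition im_trig P x y f (t : R) :=
  \sum_(i | P i) (x i * sin (f i * t) + y i * cos (f i * t)).

(** The square of the modulus of the sum of the (x_i + i y_i) e^{i f_i t}. *)
Definition normsq_trig P x y f (t : R) :=
  re_trig P x y f t ^+ 2 + im_trig P x y f t ^+ 2.

Lemma normsq_trigE P x y f t : normsq_trig P x y f t =
  \sum_(i | P i) \sum_(j | P j)
    ((x i * x j + y i * y j) * cos ((f i - f j) * t) +
     (x i * y j - y i * x j) * sin ((f i - f j) * t)).
Proof.
rewrite /normsq_trig !expr2 /re_trig /im_trig !big_distrlr /= -big_split.
apply: eq_bigr => i _; rewrite -big_split; apply: eq_bigr => j _ /=.
rewrite [(f i - f j) * t]mulrBl cosB sinB; ring.
Qed.

Lemma continuous_cosM (c : R) : continuous (fun t : R => cos (c * t)).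
Proof.
move=> t; apply: (@continuous_comp _ _ _ (fun t => c * t) cos).
  exact: mulrl_continuous.
exact: continuous_cos.
Qed.

Lemma continuous_sinM (c : R) : continuous (fun t : R => sin (c * t)).
Proof.
move=> t; apply: (@continuous_comp _ _ _ (fun t => c * t) sin).
  exact: mulrl_continuous.
exact: continuous_sin.
Qed.

Lemma continuous_mul (g h : R -> R) :
  continuous g -> continuous h -> continuous (fun t => g t * h t).
Proof. by move=> cg ch t; apply: continuousM; [exact: cg|exact: ch]. Qed.

Lemma continuous_add (g h : R -> R) :
  continuous g -> continuous h -> continuous (fun t => g t + h t).
Proof. by move=> cg ch t; apply: continuousD; [exact: cg|exact: ch]. Qed.

Lemma continuous_scale (c : R) (g : R -> R) :
  continuous g -> continuous (fun t => c * g t).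
Proof. by move=> cg; apply: continuous_mul => // t; exact: cvg_cst. Qed.

Lemma continuous_re_trig P x y f : continuous (re_trig P x y f).
Proof.
apply: continuous_sumr => i.
apply: continuous_add; first by apply: continuous_scale; exact: continuous_cosM.
move=> t; apply: (@continuousN _ _ _ (fun t => y i * sin (f i * t))).
by apply: continuous_scale; exact: continuous_sinM.
Qed.

Lemma continuous_normsq_trig P x y f : continuous (normsq_trig P x y f).
Proof.
have cim : continuous (im_trig P x y f).
  apply: continuous_sumr => i; apply: continuous_add; apply: continuous_scale;
    [exact: continuous_sinM|exact: continuous_cosM].
have cre := @continuous_re_trig P x y f.
by apply: continuous_add; apply: continuous_mul.
Qed.

End trigonometric_sums.

Section fourier.
Context {R : realType}.
Implicit Types (A : set (measurableTypeR R)) (w : R -> R).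

Definition cos_transform A w (x : R) :=
  \int[lebesgue_measure]_(t in A) (w t * cos (x * t)).

Definition sin_transform A w (x : R) :=
  \int[lebesgue_measure]_(t in A) (w t * sin (x * t)).

(** The cosine and sine transforms are the real and imaginary parts of the
    Fourier transform of w restricted to A, so this is the expansion of the
    weighted L^2 norm of a trigonometric sum as a Hermitian form. *)
Lemma Rintegral_normsq_trig A w (I : finType) (P : pred I) (x y f : I -> R) :
  bounded_measurable A -> continuous w ->
  \int[lebesgue_measure]_(t in A) (w t * normsq_trig P x y f t) =
  \sum_(i | P i) \sum_(j | P j)
    ((x i * x j + y i * y j) * cos_transform A w (f i - f j) +
     (x i * y j - y i * x j) * sin_transform A w (f i - f j)).
Proof.
move=> bA cw.
have cwc c : continuous (fun t => w t * cos (c * t)).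
  by apply: continuous_mul => //; exact: continuous_cosM.
have cws c : continuous (fun t => w t * sin (c * t)).
  by apply: continuous_mul => //; exact: continuous_sinM.
have E t : w t * normsq_trig P x y f t = \sum_(i | P i) \sum_(j | P j)
    ((x i * x j + y i * y j) * (w t * cos ((f i - f j) * t)) +
     (x i * y j - y i * x j) * (w t * sin ((f i - f j) * t))).
  rewrite normsq_trigE mulr_sumr; apply: eq_bigr => i _.
  by rewrite mulr_sumr; apply: eq_bigr => j _; ring.
under eq_Rintegral do rewrite E.
have cterm i j : continuous (fun t =>
    (x i * x j + y i * y j) * (w t * cos ((f i - f j) * t)) +
    (x i * y j - y i * x j) * (w t * sin ((f i - f j) * t))).
  by apply: continuous_add; apply: continuous_scale.
rewrite Rintegral_sumr//; last by move=> i; exact: continuous_sumr.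
apply: eq_bigr => i _; rewrite Rintegral_sumr//; apply: eq_bigr => j _.
have mA := bA.1.
rewrite RintegralD//; last 2 first.
- by apply: continuous_integrable => //; exact: continuous_scale.
- by apply: continuous_integrable => //; exact: continuous_scale.
by rewrite !RintegralZl//; exact: continuous_integrable.
Qed.

End fourier.

(** * The Fourier transform of the weight L^2 - t^2 *)

Section quadratic_weight.
Context {R : realType}.

Lemma Rintegral_derive (F f : R -> R) (a b : R) : a < b -> continuous f ->
  (forall t : R, is_derive t 1 F (f t)) ->
  \int[lebesgue_measure]_(t in `[a, b]) f t = F b - F a.
Proof.
move=> ab cf dF; rewrite /Rintegral (@continuous_FTC2 _ _ F)//.
- exact: continuous_subspaceT.
- have cF (t : R) : {for t, continuous F}.
    by apply/differentiable_continuous/derivable1_diffP; exact: ex_derive.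
  split.
  + by move=> t _; exact: ex_derive.
  + exact/cvg_at_right_filter/cF.
  + exact/cvg_at_left_filter/cF.
- by move=> t _; rewrite derive1E derive_val.
Qed.

Lemma is_derive_mul (g h : R -> R) (t dg dh : R) :
  is_derive t 1 g dg -> is_derive t 1 h dh ->
  is_derive t 1 (fun s => g s * h s) (g t * dh + h t * dg).
Proof. by move=> ? ?; exact: is_deriveM. Qed.

Lemma is_derive_add (g h : R -> R) (t dg dh : R) :
  is_derive t 1 g dg -> is_derive t 1 h dh ->
  is_derive t 1 (fun s => g s + h s) (dg + dh).
Proof. by move=> ? ?; exact: is_deriveD. Qed.

Lemma is_derive_sinM (x t : R) :
  is_derive t 1 (fun s => sin (x * s)) (x * cos (x * t)).
Proof.
have d : is_derive t 1 (fun s : R => x * s) x.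
  apply: is_derive_eq (is_derive_mul (is_derive_cst x t 1) (is_derive_id t 1)) _.
  by rewrite /=; ring.
by apply: is_derive_eq (is_derive1_comp (is_derive_sin (x * t)) d) _; rewrite mulrC.
Qed.

Lemma is_derive_cosM (x t : R) :
  is_derive t 1 (fun s => cos (x * s)) (- x * sin (x * t)).
Proof.
have d : is_derive t 1 (fun s : R => x * s) x.
  apply: is_derive_eq (is_derive_mul (is_derive_cst x t 1) (is_derive_id t 1)) _.
  by rewrite /=; ring.
apply: is_derive_eq (is_derive1_comp (is_derive_cos (x * t)) d) _.
by rewrite !mulNr mulrC.
Qed.

(** The primitives below are combinations of a sine and a cosine with
    quadratic coefficients, found by integrating by parts twice; this shape
    lets one lemma differentiate all the coefficients. *)
Lemma is_derive_quadratic (a b c t : R) :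
  is_derive t 1 (fun s : R => a + b * s + c * (s * s)) (b + 2 * c * t).
Proof.
have dc (k : R) := is_derive_cst k t 1.
have di := is_derive_id t (1 : R).
have H := is_derive_add (is_derive_add (dc a) (is_derive_mul (dc b) di))
  (is_derive_mul (dc c) (is_derive_mul di di)).
apply: is_derive_eq H _.
by rewrite /=; ring.
Qed.

Definition quadratic_weight (L t : R) := L ^+ 2 - t ^+ 2.

Lemma continuous_quadratic_weight L : continuous (quadratic_weight L).
Proof.
have -> : quadratic_weight L = (fun t => L ^+ 2 + -1 * (t * t)).
  by apply/funext => t; rewrite /quadratic_weight; ring.
apply: continuous_add; first by move=> t; exact: cvg_cst.
by apply: continuous_scale; apply: continuous_mul => t; exact: cvg_id.
Qed.

(** The integrand is odd; its explicit primitive F is even. *)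
Lemma sin_transform_quadratic_weight (L x : R) : 0 < L ->
  sin_transform `[- L, L] (quadratic_weight L) x = 0.
Proof.
move=> L0; have [->|x0] := eqVneq x 0.
  rewrite /sin_transform; under eq_Rintegral do rewrite mul0r sin0 mulr0.
  by rewrite Rintegral_cst ?mul0r//; exact: measurable_itv.
pose F (t : R) :=
  (- L ^+ 2 / x - 2 / x ^+ 3 + 0 * t + x^-1 * (t * t)) * cos (x * t) +
  (0 + (- 2 / x ^+ 2) * t + 0 * (t * t)) * sin (x * t).
have dF (t : R) : is_derive t 1 F (quadratic_weight L t * sin (x * t)).
  have dq (a b c : R) := is_derive_quadratic a b c t.
  have H a b c a' b' c' := is_derive_add
    (is_derive_mul (dq a b c) (is_derive_cosM x t))
    (is_derive_mul (dq a' b' c') (is_derive_sinM x t)).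
  apply: is_derive_eq (H _ _ _ _ _ _) _.
  by rewrite /quadratic_weight; field.
rewrite /sin_transform (Rintegral_derive _ _ dF); first last.
- by apply: continuous_mul;
    [exact: continuous_quadratic_weight|exact: continuous_sinM].
- by rewrite gtrN.
by rewrite /F !mulrN cosN sinN; ring.
Qed.

(** Two integrations by parts: the boundary term of the first one vanishes with
    the weight at the ends -L and L, so that no 1 / x term survives. *)
Lemma cos_transform_quadratic_weight_le (L x : R) : 0 < L -> 2^-1 <= `|x| ->
  `|cos_transform `[- L, L] (quadratic_weight L) x| <= (4 * L + 8) / x ^+ 2.
Proof.
move=> L0 x12.
have nx0 : 0 < `|x| by apply: lt_le_trans x12; rewrite invr_gt0.
have x0 : x != 0 by rewrite -normr_gt0.
pose F (t : R) :=
  (L ^+ 2 / x + 2 / x ^+ 3 + 0 * t + (- x^-1) * (t * t)) * sin (x * t) +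
  (0 + (- 2 / x ^+ 2) * t + 0 * (t * t)) * cos (x * t).
have dF (t : R) : is_derive t 1 F (quadratic_weight L t * cos (x * t)).
  have dq (a b c : R) := is_derive_quadratic a b c t.
  have H a b c a' b' c' := is_derive_add
    (is_derive_mul (dq a b c) (is_derive_sinM x t))
    (is_derive_mul (dq a' b' c') (is_derive_cosM x t)).
  apply: is_derive_eq (H _ _ _ _ _ _) _.
  by rewrite /quadratic_weight; field.
rewrite /cos_transform (Rintegral_derive _ _ dF); first last.
- by apply: continuous_mul;
    [exact: continuous_quadratic_weight|exact: continuous_cosM].
- by rewrite gtrN.
have -> : F L - F (- L) =
    (4 * (sin (x * L) / x) - 4 * L * cos (x * L)) / x ^+ 2.
  by rewrite /F !mulrN cosN sinN; field.
rewrite normrM normfV normrX real_normK ?num_real//.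
rewrite ler_pM2r; last by rewrite invr_gt0 exprn_even_gt0.
apply: (le_trans (ler_normB _ _)).
have hs : `|4 * (sin (x * L) / x)| <= 8.
  rewrite normrM normrM normfV (ger0_norm (ler0n _ _)).
  rewrite (_ : 8 = 4 * (1 * 2)); last by ring.
  rewrite ler_pM2l// ler_pM ?invr_ge0//.
    by rewrite ler_norml sin_geN1 sin_le1.
  by rewrite -[2]invrK lef_pV2// posrE.
have hc : `|4 * L * cos (x * L)| <= 4 * L.
  rewrite normrM ger0_norm; last by rewrite mulr_ge0// ltW.
  rewrite ler_piMr//; first by rewrite mulr_ge0// ltW.
  by rewrite ler_norml cos_geN1 cos_le1.
lra.
Qed.

End quadratic_weight.

(** * Bessel's inequality for separated frequencies *)

Section separated_frequencies.
Context {R : realType}.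

Definition half_separated (I : finType) (P : pred I) (f : I -> R) :=
  forall i j, P i -> P j -> i != j -> 2^-1 <= `|f i - f j|.

(** Telescoping, from 1 / (m + 1)^2 <= 1 / m - 1 / (m + 1). *)
Lemma sum_inv_sqr_le2 (s : seq nat) : uniq s -> all (fun m => 0 < m)%N s ->
  \sum_(m <- s) (m%:R ^+ 2)^-1 <= 2 :> R.
Proof.
move=> us /allP s0.
pose M := \max_(m <- s) m.
have sM m : m \in s -> (m <= M)%N by move=> ms; exact: leq_bigmax_seq.
have telescope n : \sum_(1 <= m < n.+2) (m%:R ^+ 2)^-1 <= 2 - n.+1%:R^-1 :> R.
  elim: n => [|n IHn].
    by rewrite big_nat1 expr1n invr1; lra.
  rewrite big_nat_recr//=; apply: (le_trans (lerD IHn (lexx _))).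
  set u : R := n.+1%:R.
  have u0 : 0 < u by rewrite ltr0n.
  have -> : n.+2%:R = u + 1 :> R by rewrite /u -natr1.
  rewrite -subr_ge0.
  have -> : 2 - (u + 1)^-1 - (2 - u^-1 + ((u + 1) ^+ 2)^-1) =
            (u * (u + 1) ^+ 2)^-1.
    by field; rewrite !gt_eqF//; lra.
  by rewrite invr_ge0 mulr_ge0 ?sqr_ge0// ltW.
have -> : \sum_(m <- s) (m%:R ^+ 2)^-1 =
    \sum_(1 <= m < M.+2 | m \in s) (m%:R ^+ 2)^-1 :> R.
  rewrite -[RHS]big_filter; apply/perm_big/uniq_perm => //.
    by rewrite filter_uniq// iota_uniq.
  move=> m; rewrite mem_filter mem_index_iota.
  by case: (boolP (m \in s)) => //= ms; rewrite s0//= ltnS (leq_trans (sM _ ms)).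
apply: (@le_trans _ _ (\sum_(1 <= m < M.+2) (m%:R ^+ 2)^-1)).
  rewrite big_mkcond; apply: ler_sum => m _; case: ifP => // _.
by apply: (le_trans (telescope M)); rewrite gerBl invr_ge0.
Qed.

(** The integer part of twice the distance to c takes each value at most
    once on points which are 1/2-separated, and it is positive by the second
    hypothesis; the sum is thus compared with the sum of the 4 / m^2. *)
Lemma one_sided_separated_sum (I : finType) (P : pred I) (f : I -> R) (c : R) :
  half_separated P f -> (forall j, P j -> 2^-1 <= f j - c) ->
  \sum_(j | P j) ((f j - c) ^+ 2)^-1 <= 8.
Proof.
move=> sepf fc.
pose m j := Num.truncn (2 * (f j - c)).
have m_itv j : P j -> (m j)%:R <= 2 * (f j - c) < (m j).+1%:R.
  by move=> Pj; apply: truncn_itv; have := fc j Pj; lra.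
have m0 j : P j -> (0 < m j)%N.
  by move=> Pj; rewrite truncn_gt0; have := fc j Pj; lra.
have minj : {in P &, injective m}.
  move=> i j Pi Pj mij; apply/eqP/negPn/negP => /(sepf _ _ Pi Pj).
  have := m_itv i Pi; have := m_itv j Pj; rewrite mij -[(m j).+1%:R]natr1.
  move: (m j)%:R => {mij} k /andP[? ?] /andP[? ?].
  rewrite real_ler_normr ?num_real// => /orP[] ?; lra.
apply: (@le_trans _ _ (\sum_(j | P j) 4 * ((m j)%:R ^+ 2)^-1)).
  apply: ler_sum => j Pj.
  have k0 : 0 < (m j)%:R :> R by rewrite ltr0n m0.
  have /andP[kle _] := m_itv j Pj.
  have d0 : 0 < f j - c by apply: lt_le_trans (fc j Pj); rewrite invr_gt0.
  rewrite -[4]invrK -invfM lef_pV2 ?posrE ?mulr_gt0 ?exprn_gt0//.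
  rewrite -ler_pdivlMl ?invr_gt0// invrK (_ : 4 = 2 ^+ 2); last by ring.
  by rewrite -exprMn lerXn2r// nnegrE ?mulr_ge0// ltW.
rewrite -mulr_sumr (_ : 8 = 4 * 2); last by ring.
rewrite ler_pM2l// -big_filter.
rewrite -[leLHS](big_map m xpredT (fun k => (k%:R ^+ 2)^-1)).
apply: sum_inv_sqr_le2.
- rewrite map_inj_in_uniq ?filter_uniq ?index_enum_uniq// => i j.
  by rewrite !mem_filter => /andP[Pi _] /andP[Pj _]; exact: minj.
- by apply/allP => k /mapP[j jP ->]; move: jP; rewrite mem_filter => /andP[Pj _]; exact: m0.
Qed.

Lemma separated_sum (I : finType) (P : pred I) (f : I -> R) (i : I) :
  half_separated P f -> P i ->
  \sum_(j | P j && (j != i)) ((f i - f j) ^+ 2)^-1 <= 16.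
Proof.
move=> sepf Pi.
rewrite (bigID (fun j => f i < f j))/= (_ : 16 = 8 + 8); last by ring.
have far j : P j -> j != i -> 2^-1 <= `|f i - f j|.
  by move=> Pj ji; apply: sepf => //; rewrite eq_sym.
apply: lerD.
- under eq_bigr do rewrite -sqrrN opprB.
  apply: one_sided_separated_sum => [j k /andP[/andP[Pj _] _] /andP[/andP[Pk _] _]|].
    exact: sepf.
  move=> j /andP[/andP[Pj ji] fij].
  by have := far j Pj ji; rewrite ler0_norm; lra.
- under eq_bigr do rewrite addrC -[X in _ + X]opprK.
  apply: (@one_sided_separated_sum _ _ (fun j => - f j)) =>
    [j k /andP[/andP[Pj _] _] /andP[/andP[Pk _] _] jk|].
    by rewrite -opprD normrN; exact: sepf.
  move=> j /andP[/andP[Pj ji]]; rewrite -leNgt => fij.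
  by have := far j Pj ji; rewrite ger0_norm; lra.
Qed.

(** Bound 2 |x_i x_j + y_i y_j| by the sum of the squared moduli of the i-th and
    j-th coefficients; by symmetry both halves give the same row sums. *)
Lemma schur_test (I : finType) (P : pred I) (x y : I -> R) (k : I -> I -> R)
    (C : R) :
  (forall i j, k i j = k j i) ->
  (forall i, P i -> \sum_(j | P j) `|k i j| <= C) ->
  \sum_(i | P i) \sum_(j | P j) (x i * x j + y i * y j) * k i j <=
  C * \sum_(i | P i) (x i ^+ 2 + y i ^+ 2).
Proof.
move=> ksym kC.
pose v i := x i ^+ 2 + y i ^+ 2.
have v0 i : 0 <= v i by rewrite addr_ge0 ?sqr_ge0.
apply: (@le_trans _ _ (\sum_(i | P i) \sum_(j | P j)
    (2^-1 * v i * `|k i j| + 2^-1 * v j * `|k i j|))).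
  apply: ler_sum => i _; apply: ler_sum => j _; rewrite -mulrDl.
  apply: le_trans (ler_norm _) _; rewrite normrM; apply: ler_wpM2r => //.
  have := sqr_ge0 (x i - x j); have := sqr_ge0 (y i - y j).
  have := sqr_ge0 (x i + x j); have := sqr_ge0 (y i + y j).
  by rewrite /v ler_norml => *; apply/andP; split; lra.
under eq_bigr do rewrite big_split/=.
rewrite big_split/= [X in _ + X]exchange_big/=.
rewrite [X in _ + X](_ : _ = \sum_(i | P i) \sum_(j | P j) 2^-1 * v i * `|k i j|).
  rewrite -mulr2n -[leLHS]mulr_natl !mulr_sumr; apply: ler_sum => i Pi.
  rewrite -mulr_sumr !mulrA divff// mul1r mulrC; exact: ler_wpM2r (kC i Pi).
by apply: eq_bigr => i _; apply: eq_bigr => j _; rewrite ksym.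
Qed.

(** The interval [-L, L] is larger than the one containing A so that the weight
    L^2 - t^2 is at least 1 on A. *)
Lemma large_sieve (A : set (measurableTypeR R)) : bounded_measurable A ->
  exists2 C : R, 0 < C & forall (I : finType) (P : pred I) (f x y : I -> R),
    half_separated P f ->
    \int[lebesgue_measure]_(t in A) normsq_trig P x y f t <=
    C * \sum_(i | P i) (x i ^+ 2 + y i ^+ 2).
Proof.
move=> bA; have [mA [T AT]] := bA.
pose L : R := `|T| + 1.
have L0 : 0 < L by rewrite ltr_wpDl.
pose w := quadratic_weight L.
pose J : set (measurableTypeR R) := [set` `[- L, L]].
have bJ : bounded_measurable J by split; [exact: measurable_itv|exists L].
pose k := cos_transform J w.
exists (`|k 0| + 16 * (4 * L + 8)).
  by rewrite ltr_wpDl// mulr_gt0//; lra.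
move=> I P f x y sepf.
have wJ t : t \in J -> 0 <= w t.
  rewrite in_setE /J/= in_itv/= => /andP[? ?].
  by rewrite /w /quadratic_weight; nra.
have wA t : t \in A -> 1 <= w t.
  rewrite in_setE => /AT; rewrite /= in_itv/= => /andP[? ?].
  have := ler_norm T; rewrite /w /quadratic_weight /L => ?; nra.
have AJ : A `<=` J.
  move=> t /AT; rewrite /J/= !in_itv/= => /andP[? ?].
  by have := ler_norm T; rewrite /L => ?; apply/andP; split; lra.
have n0 t : 0 <= normsq_trig P x y f t by rewrite addr_ge0 ?sqr_ge0.
apply: (@le_trans _ _
    (\int[lebesgue_measure]_(t in J) (w t * normsq_trig P x y f t))).
  apply: le_RintegralS => //.
  - exact: continuous_normsq_trig.
  - apply: continuous_mul; first exact: continuous_quadratic_weight.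
    exact: continuous_normsq_trig.
  - by move=> t At; rewrite ler_peMl// wA.
  - by move=> t Jt; rewrite mulr_ge0// wJ.
rewrite Rintegral_normsq_trig//; last exact: continuous_quadratic_weight.
under eq_bigr do under eq_bigr do
  rewrite sin_transform_quadratic_weight// mulr0 addr0.
apply: schur_test.
  move=> i j; rewrite /cos_transform; apply: eq_Rintegral => t _.
  by rewrite -opprB mulNr cosN.
move=> i Pi; rewrite (bigD1 i)//= subrr lerD2l.
apply: (@le_trans _ _ (\sum_(j | P j && (j != i))
    (4 * L + 8) * ((f i - f j) ^+ 2)^-1)).
  apply: ler_sum => j /andP[Pj ji].
  by apply: cos_transform_quadratic_weight_le => //; apply: sepf; rewrite // eq_sym.
rewrite -mulr_sumr mulrC ler_pM2r; last lra.
exact: separated_sum.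
Qed.

(** Duality with the large sieve. Let V be the sum to be bounded and g the
    real part of the trigonometric sum whose coefficients are the conjugates of
    the Fourier coefficients of the indicator function of A, so that V is the
    integral of g over A. Integrating 2 C g - C^2 <= g^2 over A and bounding the
    integral of g^2 by C V gives V <= C m, m being the measure of A. *)
Lemma bessel (A : set (measurableTypeR R)) : bounded_measurable A ->
  exists C : R, forall (I : finType) (P : pred I) (f : I -> R),
    half_separated P f ->
    \sum_(i | P i) (cos_transform A (cst 1) (f i) ^+ 2 +
                    sin_transform A (cst 1) (f i) ^+ 2) <= C.
Proof.
move=> bA; have [C C0 sieve] := large_sieve bA.
pose m := fine (lebesgue_measure A).
exists (C * m) => I P f sepf.
pose c i := cos_transform A (cst 1) (f i).
pose s i := sin_transform A (cst 1) (f i).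
set V := (X in X <= _).
have mA := bA.1.
pose g := re_trig P c (fun i => - s i) f.
have cg : continuous g by exact: continuous_re_trig.
have Vg : \int[lebesgue_measure]_(t in A) g t = V.
  have cc i : continuous (fun t => c i * cos (f i * t)).
    by apply: continuous_scale; exact: continuous_cosM.
  have cs i : continuous (fun t => s i * sin (f i * t)).
    by apply: continuous_scale; exact: continuous_sinM.
  rewrite /g /re_trig.
  under eq_Rintegral do under eq_bigr do rewrite mulNr opprK.
  rewrite Rintegral_sumr//; last by move=> i; exact: continuous_add.
  apply: eq_bigr => i _.
  rewrite RintegralD//; [|exact: continuous_integrable..].
  rewrite !RintegralZl//; last 2 first.
  - by apply: continuous_integrable => //; exact: continuous_sinM.
  - by apply: continuous_integrable => //; exact: continuous_cosM.
  rewrite !expr2 -/(c i) -/(s i); congr (_ * _ + _ * _);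
    by apply: eq_Rintegral => t _; rewrite mul1r.
have cn := @continuous_normsq_trig R I P c (fun i => - s i) f.
have cg2 : continuous (fun t => (2 * C) * g t) by exact: continuous_scale.
have cC : continuous (fun _ : R => - C ^+ 2) by move=> t; exact: cvg_cst.
have : 2 * C * V - C ^+ 2 * m <= C * V.
  have -> : 2 * C * V - C ^+ 2 * m =
      \int[lebesgue_measure]_(t in A) (2 * C * g t + - C ^+ 2).
    rewrite RintegralD//; [|exact: continuous_integrable..].
    rewrite RintegralZl//; last exact: continuous_integrable.
    by rewrite Rintegral_cst// Vg mulNr.
  have := sieve I P f c (fun i => - s i) sepf.
  under eq_bigr do rewrite sqrrN.
  apply: le_trans; apply: le_Rintegral => //.
  - by apply: continuous_integrable => //; exact: continuous_add.
  - exact: continuous_integrable.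
  - move=> t _; have := sqr_ge0 (g t - C); have := sqr_ge0 (im_trig P c (fun i => - s i) f t).
    rewrite /normsq_trig -/(g t); nra.
move=> H; rewrite -(ler_pM2l C0); move: H; rewrite expr2; nra.
Qed.

End separated_frequencies.

(** * From the hypotheses to separated gaps and bounded partial sums *)

Lemma finite_esum_superlevel (R : realType) (T : choiceType) (S : set T)
    (f : T -> \bar R) (c : R) :
  0 < c -> (forall i, S i -> 0 <= f i)%E -> (\esum_(i in S) f i < +oo)%E ->
  finite_set [set i | S i /\ (c%:E <= f i)%E].
Proof.
move=> c0 f0 sf; apply: contrapT => infS.
have sf_fin : (\esum_(i in S) f i) \is a fin_num.
  by rewrite ge0_fin_numE//; exact: esum_ge0.
pose s := fine (\esum_(i in S) f i).
have s0 : 0 <= s by apply: fine_ge0; exact: esum_ge0.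
pose n := Num.bound (s / c).
have [B BS nB] := infinite_set_fset n infS.
have : (s%:E < \esum_(i in S) f i)%E.
  apply: (@lt_le_trans _ _ (n%:R * c)%:E).
    by rewrite lte_fin -ltr_pdivrMr// archi_boundP// divr_ge0// ltW.
  apply: esum_ge; exists [set` B].
    by split; [exact: finite_fset|move=> i /BS[]].
  rewrite fsbig_finite//= set_fsetK.
  apply: (@le_trans _ _ (\sum_(i <- B) c%:E)%E).
    rewrite sumEFin lee_fin big_const_seq count_predT iter_addr_0 mulr_natl.
    by rewrite ler_wpMn2l// ltW.
  by rewrite !big_seq; apply: lee_sum => i /BS[].
by rewrite /s fineK// ltxx.
Qed.

(** Two gaps at distance less than 1/2 contribute more than 1/4 to the sum, so
    only finitely many pairs of gaps are that close; take n0 beyond the first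
    indices occurring in them. *)
Lemma separated_gaps (R : realType) (lambda : nat -> R) :
  (\esum_(pq in gap_quadruples)
     ((pospart (1 - `|gap lambda pq.1 - gap lambda pq.2|)) ^+ 2)%:E < +oo)%E ->
  exists n0 : nat, forall p q : nat * nat,
    [/\ n0 <= p.1, n0 <= p.2 & p.1 != p.2]%N ->
    [/\ n0 <= q.1, n0 <= q.2 & q.1 != q.2]%N ->
    p != q -> 2^-1 <= `|gap lambda p - gap lambda q|.
Proof.
move=> fin_gaps.
have c0 : 0 < 4^-1 :> R by rewrite invr_gt0.
have := finite_esum_superlevel c0 _ fin_gaps.
move=> /(_ _)/wrap[].
  by move=> pq _; rewrite lee_fin sqr_ge0.
set D := [set pq | _]; move=> finD.
have finD1 : finite_set [set pq.1.1 | pq in D] by exact: finite_image.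
exists (\max_(k <- fset_set [set pq.1.1 | pq in D]) k).+1 => p q.
move=> [p1 p2 p12] [q1 q2 q12] pq; rewrite leNgt; apply/negP => close.
have : D (p, q).
  split; first by split => /=; [exact/eqP|exact/eqP|exact/eqP].
  rewrite /= lee_fin /pospart max_l; last by lra.
  rewrite (_ : 4^-1 = 2^-1 ^+ 2); last by rewrite exprVn; congr (_^-1); ring.
  by rewrite lerXn2r// ?nnegrE; lra.
move=> Dpq.
have p1D : p.1 \in fset_set [set pq.1.1 | pq in D].
  by rewrite in_fset_set//; apply/mem_set; exists (p, q).
by move: p1; rewrite ltnNge => /negP; apply; exact: leq_bigmax_seq.
Qed.

Section bounded_partial_sums.
Context {R : realType} (lambda : nat -> R) (a : nat -> R[i]).

Definition normsq_partial_sum (n : nat) (t : R) :=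
  @normsq_trig R 'I_n xpredT (fun k => complex.Re (a k))
    (fun k => complex.Im (a k)) (fun k => lambda k) t.

Lemma series_trigE (n : nat) (t : R) :
  series (fun k => a k * expi (lambda k * t) : R[i]^o) n =
  (@re_trig R 'I_n xpredT (fun k => complex.Re (a k))
     (fun k => complex.Im (a k)) (fun k => lambda k) t +i*
   @im_trig R 'I_n xpredT (fun k => complex.Re (a k))
     (fun k => complex.Im (a k)) (fun k => lambda k) t)%C.
Proof.
rewrite /series/= big_mkord /re_trig /im_trig.
elim: n => [|n IHn]; first by rewrite !big_ord0.
rewrite !big_ord_recr/= IHn /expi; case: (a n) => x y /=.
by rewrite /GRing.mul/= /GRing.add/=.
Qed.

(** Bounding t and all the partial sums by the same M keeps the union below
    countable with a single index. *)
Definition partial_sum_level (M : nat) : set (measurableTypeR R) :=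
  [set` `[- M%:R, M%:R]] `&`
  \bigcap_(n in setT) [set t | normsq_partial_sum n t <= M%:R].

Lemma bounded_measurable_partial_sum_level M : bounded_measurable (partial_sum_level M).
Proof.
split; last by exists M%:R; exact: subIsetl.
apply: measurableI; first exact: measurable_itv.
apply: bigcap_measurableType => n _; apply: measurable_realfun.closed_measurable.
rewrite [X in closed X](_ : _ = normsq_partial_sum n @^-1` [set x | x <= M%:R])//.
apply: closed_comp; last exact: closed_le.
by move=> t _; exact: continuous_normsq_trig.
Qed.

Lemma convergence_set_sub_levels :
  convergence_set lambda a `<=` \bigcup_M partial_sum_level M.
Proof.
move=> t /cvg_seq_bounded /pinfty_ex_gt0[[M Mi]].
rewrite ltcE/= => /andP[_ M0] bM.
pose N := Num.bound (M ^+ 2 + `|t|).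
have NM : M ^+ 2 + `|t| < N%:R by apply: archi_boundP; rewrite addr_ge0 ?sqr_ge0.
exists N => //; split.
  rewrite /= in_itv/= -ler_norml.
  by apply: le_trans (ltW NM); rewrite lerDr sqr_ge0.
move=> n _ /=.
have := bM n I; rewrite series_trigE normc_def lecE/= => /andP[_].
rewrite -/(normsq_partial_sum n t) => le_M.
apply: le_trans (ltW NM); apply: ler_wpDr => //.
have n0 : 0 <= normsq_partial_sum n t by rewrite addr_ge0 ?sqr_ge0.
by rewrite -[leLHS]sqr_sqrtr// lerXn2r// nnegrE ?sqrtr_ge0// ltW.
Qed.

(** Lebesgue measure is defined on all sets as an outer measure, so monotonicity
    and countable subadditivity apply to the convergence set directly. *)
Lemma partial_sum_level_pos : (0 < lebesgue_measure (convergence_set lambda a))%E ->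
  exists M, (0 < lebesgue_measure (partial_sum_level M))%E.
Proof.
move=> pos; apply: contrapT => /forallNP null.
have null0 M : lebesgue_measure (partial_sum_level M) = 0%E.
  by apply/eqP; rewrite eq_le measure_ge0 andbT leNgt; apply/negP/null.
have : (lebesgue_measure (convergence_set lambda a) <= 0)%E; last by rewrite leNgt pos.
apply: (@le_trans _ _ (lebesgue_measure (\bigcup_M partial_sum_level M))).
  exact/le_mu_ext/convergence_set_sub_levels.
apply: le_trans (@mu_ext_sigma_subadditive _ _ _ _ _ _) _.
  by move=> X; exact: wlength_ge0.
by rewrite eseries0 => [//|i _ _]; exact: null0.
Qed.

End bounded_partial_sums.

(** * Smallness of the off-diagonal part *)

Section double_tail.
Context {R : realType}.

(** The square [n, N)^2 is disjoint from [0, n)^2 inside [0, N)^2, so its sum is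
    at most the increment of the bounded nondecreasing sequence of the sums over
    [0, N)^2. *)
Lemma double_sum_tail (phi : nat -> nat -> R) (C : R) (n0 : nat) (e : R) :
  (forall k l, 0 <= phi k l) ->
  (forall N, \sum_(0 <= k < N) \sum_(0 <= l < N) phi k l <= C) -> 0 < e ->
  exists2 n1, (n0 <= n1)%N & forall N, (n1 <= N)%N ->
    \sum_(n1 <= k < N) \sum_(n1 <= l < N) phi k l <= e.
Proof.
move=> phi0 phiC e0.
pose W N := \sum_(0 <= k < N) \sum_(0 <= l < N) phi k l.
have W_split n N : (n <= N)%N ->
    W n + \sum_(n <= k < N) \sum_(n <= l < N) phi k l <= W N.
  move=> nN; rewrite /W [leRHS](big_cat_nat (leq0n n) nN)//=; apply: lerD.
    apply: ler_sum => k _; rewrite [leRHS](big_cat_nat (leq0n n) nN)//= lerDl.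
    by apply: sumr_ge0.
  apply: ler_sum => k _; rewrite [leRHS](big_cat_nat (leq0n n) nN)//= lerDr.
  by apply: sumr_ge0.
have tail0 n N : 0 <= \sum_(n <= k < N) \sum_(n <= l < N) phi k l.
  by apply: sumr_ge0 => k _; exact: sumr_ge0.
have W_nd : {homo W : n m / (n <= m)%N >-> n <= m}.
  by move=> n m nm; apply: le_trans (W_split _ _ nm); rewrite lerDl.
have W_cvg : cvgn W.
  by apply: nondecreasing_is_cvgn => //; exists C => _ [N _ <-]; exact: phiC.
have W_lim N := nondecreasing_cvgn_le W_nd W_cvg N.
have : \forall n \near \oo, `|limn W - W n| < e.
  by move/cvgrPdist_lt : W_cvg; apply.
case=> n2 _ near_lim; exists (maxn n0 n2); first exact: leq_maxl.
move=> N nN.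
have := near_lim (maxn n0 n2) (leq_maxr _ _).
rewrite /= ltr_norml => /andP[_].
by have := W_split _ _ nN; have := W_lim N; lra.
Qed.

(** The off-diagonal part is at most sqrt (sum of |c + i s|^2) times Q by the
    Cauchy-Schwarz inequality, Q being the sum of the squared moduli of the
    coefficients, hence at most m Q / 2. The proof uses the arithmetic-geometric
    form: for z = x_i conj(x_j) and w = c - i s, expand 0 <= |m z + 2 Q w|^2, where
    the ratio of m to 2 Q is the optimal one. *)
Lemma diagonal_dominance (I : finType) (P : pred I) (x y : I -> R)
    (c s : I -> I -> R) (m : R) :
  0 < m -> (forall i, c i i = m) -> (forall i, s i i = 0) ->
  \sum_(i | P i) \sum_(j | P j && (j != i)) (c i j ^+ 2 + s i j ^+ 2) <=
    m ^+ 2 / 4 ->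
  m / 2 * (\sum_(i | P i) (x i ^+ 2 + y i ^+ 2)) <=
  \sum_(i | P i) \sum_(j | P j)
    ((x i * x j + y i * y j) * c i j + (x i * y j - y i * x j) * s i j).
Proof.
move=> m0 cm s0 small.
set Q := \sum_(i | P i) (x i ^+ 2 + y i ^+ 2).
set G := \sum_(i | P i) _.
pose v i := x i ^+ 2 + y i ^+ 2.
have v0 i : 0 <= v i by rewrite addr_ge0 ?sqr_ge0.
pose g i j := (x i * x j + y i * y j) * c i j + (x i * y j - y i * x j) * s i j.
have [Q0|Q0] := eqVneq Q 0.
  have vz i : P i -> v i = 0.
    exact: psumr_eq0P (fun j _ => v0 j) Q0 i.
  rewrite Q0 mulr0; apply: sumr_ge0 => i Pi; apply: sumr_ge0 => j _.
  have /eqP := vz i Pi; rewrite /v paddr_eq0 ?sqr_ge0// !sqrf_eq0.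
  by move=> /andP[/eqP -> /eqP ->]; rewrite !mul0r subr0 addr0 !mul0r addr0.
have Qpos : 0 < Q by rewrite lt_def Q0; apply: sumr_ge0 => i _; exact: v0.
have offdiag i j : - (m ^+ 2 * v i * v j) - 4 * Q ^+ 2 * (c i j ^+ 2 + s i j ^+ 2)
    <= 4 * m * Q * g i j.
  have := sqr_ge0 (m * (x i * x j + y i * y j) + 2 * Q * c i j).
  have := sqr_ge0 (m * (x i * y j - y i * x j) + 2 * Q * s i j).
  by rewrite /g /v => *; lra.
have diag i : - (m ^+ 2 * v i * v i) + 4 * m * Q * (m * v i) <=
    4 * m * Q * g i i.
  have -> : g i i = m * v i by rewrite /g /v cm s0; ring.
  rewrite gerDr oppr_le0; apply: mulr_ge0 => //; apply: mulr_ge0 => //.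
  exact: sqr_ge0.
have QE : Q = \sum_(i | P i) v i by [].
have GE : G = \sum_(i | P i) \sum_(j | P j) g i j by [].
clearbody Q G v g.
have row i : P i -> - (m ^+ 2 * v i * Q) + 4 * m * Q * (m * v i) -
    4 * Q ^+ 2 * \sum_(j | P j && (j != i)) (c i j ^+ 2 + s i j ^+ 2) <=
    4 * m * Q * \sum_(j | P j) g i j.
  move=> Pi; rewrite {1}QE (bigD1 i)//= [X in _ <= _ * X](bigD1 i)//=.
  rewrite mulrDr opprD !mulrDr.
  have := diag i.
  have : - (m ^+ 2 * v i * \sum_(j | P j && (j != i)) v j) -
      4 * Q ^+ 2 * (\sum_(j | P j && (j != i)) (c i j ^+ 2 + s i j ^+ 2)) <=
      4 * m * Q * \sum_(j | P j && (j != i)) g i j.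
    rewrite !mulr_sumr -!sumrN -big_split/=; apply: ler_sum => j _.
    exact: offdiag.
  by move=> *; lra.
have total : - (m ^+ 2 * Q * Q) + 4 * m * Q * (m * Q) -
    4 * Q ^+ 2 * (\sum_(i | P i) \sum_(j | P j && (j != i))
      (c i j ^+ 2 + s i j ^+ 2)) <= 4 * m * Q * G.
  rewrite GE [leRHS]mulr_sumr; apply: le_trans (ler_sum _ row).
  rewrite !big_split/= !sumrN -!mulr_sumr -!mulr_suml -!mulr_sumr.
  by rewrite -QE.
set S := \sum_(i | P i) _ in small total.
have Q2S : 4 * Q ^+ 2 * S <= m ^+ 2 * Q ^+ 2.
  rewrite (_ : m ^+ 2 * Q ^+ 2 = 4 * Q ^+ 2 * (m ^+ 2 / 4)); last by field.
  by apply: ler_wpM2l small; rewrite mulr_ge0// sqr_ge0.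
have mQ : 0 < 4 * m * Q by rewrite !mulr_gt0.
rewrite -(ler_pM2l mQ); clearbody S; clear -Q2S total; lra.
Qed.

End double_tail.

(** * Square summability of the coefficients *)

Lemma big_ord_geqB (V : zmodType) (n N : nat) (F : nat -> V) : (n <= N)%N ->
  \sum_(i < N | (n <= i)%N) F i = \sum_(i < N) F i - \sum_(i < n) F i.
Proof.
move=> nN; rewrite -[LHS](big_geq_mkord n N xpredT F) -!(big_mkord xpredT F).
by rewrite [in RHS](big_cat_nat (leq0n n) nN)/= addrC addrK.
Qed.

(** A block is a difference of two partial sums, and |u - v|^2 is at most
    2 |u|^2 + 2 |v|^2. *)
Lemma normsq_trig_block_le (R : realType) (x y f : nat -> R) (n N : nat)
    (t B : R) : (n <= N)%N ->
  (forall k, @normsq_trig R 'I_k xpredT x y f t <= B) ->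
  @normsq_trig R 'I_N (fun i => n <= i)%N x y f t <= 4 * B.
Proof.
move=> nN le_B; have := le_B N; have := le_B n.
rewrite /normsq_trig /re_trig /im_trig.
rewrite (big_ord_geqB (fun i => x i * cos (f i * t) - y i * sin (f i * t)) nN).
rewrite (big_ord_geqB (fun i => x i * sin (f i * t) + y i * cos (f i * t)) nN).
move: (\sum_(i < N) _) (\sum_(i < N) _) (\sum_(i < n) _) (\sum_(i < n) _).
move=> u v u' v' le1 le2.
have := sqr_ge0 (u + u'); have := sqr_ge0 (v + v'); lra.
Qed.

Lemma fin_num_bounded_measurable (R : realType) (A : set (measurableTypeR R)) :
  bounded_measurable A -> lebesgue_measure A \is a fin_num.
Proof.
move=> bA; rewrite ge0_fin_numE; last exact: measure_ge0.
have := @continuous_integrable R A (cst 1) bA (@cst_continuous R R 1).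
move=> /integrableP[_]; under eq_integral do rewrite /= normr1.
by rewrite integral_cst ?mul1e//; exact: bA.1.
Qed.


Theorem theorem4p3 (R : realType) (lambda : nat -> R) (a : nat -> R[i])
    (lambda_incr : increasing_seq lambda)
    (lambda_gt0 : forall k, 0 < lambda k)
    (gap_sum_fin :
      (\esum_(pq in gap_quadruples)
         ((pospart (1 - `|gap lambda pq.1 - gap lambda pq.2|)) ^+ 2)%:E
       < +oo)%E)
    (conv_pos : (0 < lebesgue_measure (convergence_set lambda a))%E) :
  cvgn (series (fun k => ComplexField.Normc.normc (a k) ^+ 2)).
Proof.
have [M A_pos] := partial_sum_level_pos conv_pos.
set A := partial_sum_level lambda a M in A_pos.
have bA : bounded_measurable A by exact: bounded_measurable_partial_sum_level.
have mA := bA.1.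
pose m := fine (lebesgue_measure A).
have m0 : 0 < m.
  apply: fine_gt0; rewrite A_pos/= -ge0_fin_numE; last exact: measure_ge0.
  exact: fin_num_bounded_measurable.
have [n0 sep] := separated_gaps gap_sum_fin.
have [C le_C] := bessel bA.
pose r x := cos_transform A (cst 1) x ^+ 2 + sin_transform A (cst 1) x ^+ 2.
have r0 x : 0 <= r x by rewrite addr_ge0 ?sqr_ge0.
pose phi k l :=
  if [&& n0 <= k, n0 <= l & k != l]%N then r (lambda k - lambda l) else 0.
have [|||n1 n01 tail] := @double_sum_tail R phi C n0 (m ^+ 2 / 4) _ _ _.
- by move=> k l; rewrite /phi; case: ifP.
- move=> N; rewrite big_mkord; under eq_bigr do rewrite big_mkord.
  rewrite pair_big/= -big_mkcond/=.
  apply: (le_C _ (fun p : 'I_N * 'I_N => [&& n0 <= p.1, n0 <= p.2 & p.1 != p.2]%N)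
    (fun p => lambda p.1 - lambda p.2)).
  move=> [i j] [k l] /= /and3P[? ? ?] /and3P[? ? ?] ne.
  by apply: (sep (val i, val j) (val k, val l)).
- by rewrite divr_gt0// exprn_gt0.
pose x k := complex.Re (a k); pose y k := complex.Im (a k).
have normcE2 k : ComplexField.Normc.normc (a k) ^+ 2 = x k ^+ 2 + y k ^+ 2.
  rewrite /x /y; case: (a k) => u v /=.
  by rewrite sqr_sqrtr// addr_ge0 ?sqr_ge0.
(* The integral over A of the squared modulus of the block is at least m / 2
   times this sum, and at most 4 M m. *)
have block N : (n1 <= N)%N ->
    \sum_(i < N | (n1 <= i)%N) (x i ^+ 2 + y i ^+ 2) <= 8 * M%:R.
  move=> nN.
  pose P (i : 'I_N) := (n1 <= i)%N.
  pose c (i j : 'I_N) := cos_transform A (cst 1) (lambda i - lambda j).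
  pose s (i j : 'I_N) := sin_transform A (cst 1) (lambda i - lambda j).
  have cm i : c i i = m.
    rewrite /c /cos_transform subrr.
    under eq_Rintegral do rewrite mul0r cos0 mulr1.
    by rewrite Rintegral_cst// mul1r.
  have s0 i : s i i = 0.
    rewrite /s /sin_transform subrr.
    under eq_Rintegral do rewrite mul0r sin0 mulr0.
    by rewrite Rintegral_cst// mul0r.
  have := @diagonal_dominance R _ P (fun i => x i) (fun i => y i) c s m m0 cm s0.
  move=> /(_ _)/wrap[].
    apply: le_trans (tail N nN); rewrite big_geq_mkord/=.
    apply: ler_sum => i Pi; rewrite big_geq_mkord/= big_mkcondr/=.
    apply: ler_sum => j Pj; rewrite /phi (leq_trans n01 Pi) (leq_trans n01 Pj)/=.
    by rewrite (eq_sym (val i)).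
  rewrite -(@Rintegral_normsq_trig R A (cst 1) _ P (fun i => x i) (fun i => y i)
    (fun i => lambda i) bA (@cst_continuous R R 1)).
  have cn := @continuous_normsq_trig R _ P (fun i => x i) (fun i => y i)
    (fun i => lambda i).
  move=> /le_trans/(_ (_ : _ <= \int[lebesgue_measure]_(t in A) (4 * M%:R)))/wrap[].
    apply: le_Rintegral => //.
    - by apply: continuous_integrable => //; apply: continuous_scale.
    - by apply: continuous_integrable => // t; exact: cvg_cst.
    - move=> t [_ At]; rewrite mul1r.
      by apply: (@normsq_trig_block_le R x y lambda) => // k; exact: At.
  rewrite Rintegral_cst// -/m => H.
  by rewrite -(ler_pM2l m0); move: H; lra.
apply: nondecreasing_is_cvgn.
  by apply: nondecreasing_series => *; exact: sqr_ge0.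
exists (\sum_(i < n1) (x i ^+ 2 + y i ^+ 2) + 8 * M%:R) => _ [N _ <-].
rewrite [X in X <= _](_ : _ = \sum_(i < N) (x i ^+ 2 + y i ^+ 2)); last first.
  by rewrite seriesEord; apply: eq_bigr => i _; rewrite normcE2.
have [nN|Nn] := leqP n1 N.
  rewrite -lerBlDl -(big_ord_geqB (fun i => x i ^+ 2 + y i ^+ 2) nN).
  exact: block.
rewrite ler_wpDr ?mulr_ge0//.
rewrite -subr_ge0 -(big_ord_geqB (fun i => x i ^+ 2 + y i ^+ 2) (ltnW Nn)).
by apply: sumr_ge0 => i _; rewrite addr_ge0 ?sqr_ge0.
Qed.
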